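(* Let $m$ be a positive integer. If $n=2m$, then $pn(\mathcal{E}_{c}(K_{n}))=m$. If $n=2m+1$, then $m\leq pn(\mathcal{E}_{c}(K_{n}))\leq m+1$.
   Context: $K_n$ denotes the complete graph on $n$ vertices. A book embedding of a graph consists of a linear order of its vertices (along the spine) together with an assignment of each edge to one of finitely many pages, such that no two edges assigned to the same page cross, where edges $ab$ and $cd$ cross iff their endpoints alternate in the linear order. The pagenumber $pn(G)$ is the minimum number of pages over all book embeddings of $G$. For a graph $G$, the complete expansion graph $\mathcal{E}_{c}(G)$ is the graph with vertex set $\{(v,e) : v\in V(G),\ e\in E(G),\ v \text{ is incident with } e\}$ and edge set $E_1\cup E_2$, where $E_1=\{(v,e)(v,f) : v\in V(G),\ e\neq f \in E(G) \text{ both incident with } v\}$ and $E_2=\{(v,e)(w,e) : e=vw\in E(G)\}$ (each vertex $v$ is replaced by a complete graph $K_{d_G(v)}$, and each edge $vw$ of $G$ becomes one edge joining these complete graphs). *)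

(* Defs.v *)
From mathcomp Require Import all_boot.

Set Implicit Arguments.
Unset Strict Implicit.
Unset Printing Implicit Defensive.

Record sgraph := SGraph {
  vertex :> finType;
  adj : rel vertex;
  adj_sym : symmetric adj;
  adj_irrefl : irreflexive adj }.

Definition edges (G : sgraph) : {set {set G}} :=
  [set e | [exists x, exists y, adj x y && (e == [set x; y])]].

Definition edge (G : sgraph) : finType := {e : {set G} | e \in edges G}.

Definition incident (G : sgraph) (v : G) (e : {set G}) : bool := v \in e.

Lemma edge_loopless (G : sgraph) (v : G) : [set v; v] \notin edges G.
Proof.
rewrite inE; apply/existsP => -[x /existsP[y /andP[xy /eqP E]]].
have xv : x = v.
  by have := set21 x y; rewrite -E !inE orbb => /eqP.
have yv : y = v.
  by have := set22 x y; rewrite -E !inE orbb => /eqP.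
by move: xy; rewrite xv yv adj_irrefl.
Qed.

Section CompleteGraph.
Variable n : nat.

Definition complete_adj : rel 'I_n := fun x y => x != y.

Lemma complete_adj_sym : symmetric complete_adj.
Proof. by move=> x y; rewrite /complete_adj eq_sym. Qed.

Lemma complete_adj_irrefl : irreflexive complete_adj.
Proof. by move=> x; rewrite /complete_adj eqxx. Qed.

Definition complete_graph : sgraph :=
  SGraph complete_adj_sym complete_adj_irrefl.

End CompleteGraph.

Section CompleteExpansion.
Variable G : sgraph.

Definition expansion_vertex : finType :=
  {p : G * {set G} | (p.2 \in edges G) && incident p.1 p.2}.

Definition expansion_E1 : rel expansion_vertex := fun p q =>
  ((val p).1 == (val q).1) && ((val p).2 != (val q).2).

Definition expansion_E2 : rel expansion_vertex := fun p q =>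
  ((val p).2 == (val q).2) && ((val p).2 == [set (val p).1; (val q).1]).

Definition expansion_adj : rel expansion_vertex := fun p q =>
  expansion_E1 p q || expansion_E2 p q.

Lemma expansion_adj_sym : symmetric expansion_adj.
Proof.
move=> p q; rewrite /expansion_adj /expansion_E1 /expansion_E2.
rewrite [(val q).1 == _]eq_sym [(val q).2 == (val p).2]eq_sym setUC.
by case: ((val p).2 =P (val q).2) => [->|//].
Qed.

Lemma expansion_adj_irrefl : irreflexive expansion_adj.
Proof.
move=> p; rewrite /expansion_adj /expansion_E1 /expansion_E2 !eqxx /=.
apply/negP => /eqP pE; have /andP[] := valP p.
by rewrite pE (negPf (edge_loopless _)).
Qed.

Definition complete_expansion : sgraph :=
  SGraph expansion_adj_sym expansion_adj_irrefl.

End CompleteExpansion.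

Section BookEmbedding.
Variable G : sgraph.

(* Endpoints of e and f alternate along the spine, where [pos v] is the position
   of v; a, b (resp. c, d) range over both orderings of the endpoints of e
   (resp. f), so it is enough to consider pos a < pos b and pos c < pos d. *)
Definition crossing (pos : G -> nat) (e f : {set G}) : bool :=
  [exists a, exists b, exists c, exists d,
    [&& e == [set a; b], f == [set c; d] &
        (pos a < pos c < pos b) && (pos b < pos d)
        || (pos c < pos a < pos d) && (pos d < pos b)]].

Definition is_book_embedding (k : nat)
    (pos : {ffun G -> 'I_#|G|}) (page : {ffun edge G -> 'I_k}) : bool :=
  injectiveb pos &&
  [forall e : edge G, forall f : edge G,
    (page e == page f) ==> ~~ crossing (fun v => pos v) (val e) (val f)].

Definition has_book_embedding (k : nat) : bool :=
  [exists pos, exists page, @is_book_embedding k pos page].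

Lemma crossing_self (pos : G -> nat) (e : {set G}) : ~~ crossing pos e e.
Proof.
apply/existsP=> -[a /existsP[b /existsP[c /existsP[d]]]].
case/and3P=> /eqP eab /eqP ecd lt_pos.
have : a \in [set c; d] by rewrite -ecd eab set21.
have : b \in [set c; d] by rewrite -ecd eab set22.
rewrite !inE => /orP[]/eqP Eb /orP[]/eqP Ea; move: lt_pos;
  by rewrite Ea Eb !ltnn ?andbF.
Qed.

Lemma ex_book_embedding : exists k, has_book_embedding k.
Proof.
exists #|edge G|; apply/existsP; exists (finfun (@enum_rank G)).
apply/existsP; exists (finfun (@enum_rank (edge G))); apply/andP; split.
  by apply/injectiveP => x y; rewrite !ffunE => /enum_rank_inj.
apply/forallP => e; apply/forallP => f; apply/implyP.
by rewrite !ffunE => /eqP/enum_rank_inj ->; apply: crossing_self.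
Qed.

Definition pagenumber : nat := ex_minn ex_book_embedding.

End BookEmbedding.

(* Main.v *)
(** Both parts come from floor(n/2) <= pn <= ceil(n/2), valid for every n >= 2.

    Upper bound. Write (v, w) for the vertex (v, vw) of the expansion. Place the
    vertices block by block, ordering the block of v by v - w mod n, and put on
    page p the edges {(v, w), (v', w')} with w + w' mod n equal to 2p or 2p + 1.
    This is the zigzag book embedding of K_n on the matching edges, and on each
    block it is the zigzag embedding of a clique, rotated so that no clique edge
    passes over an endpoint of a matching edge of its page.

    Lower bound. For n >= 6 a block is a clique on 2q + 1 vertices or more,
    where q = n/2 - 1 >= 2. The 2q + 1 long diagonals of a convex (2q + 1)-gon
    form a closed path in which any two nonconsecutive ones cross, so each page
    holds at most two of them. For n = 4 and 5 every degree is at least 3, while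
    a graph with a one-page embedding has a vertex of degree at most 2. *)
Require Import Defs.
From mathcomp Require Import all_boot.
From mathcomp Require Import zify.

Set Implicit Arguments.
Unset Strict Implicit.
Unset Printing Implicit Defensive.

(** * Book embeddings with arbitrary positions *)

(** Positions may have gaps and pages are numbers given to all vertex sets, so that explicit
    formulas fit. One order of alternation suffices by symmetry. *)
Record noncrossing (G : sgraph) (k : nat) (pos : G -> nat)
    (pg : {set G} -> nat) : Prop := Noncrossing {
  pos_inj : injective pos;
  pg_lt : forall x y, adj x y -> pg [set x; y] < k;
  pg_neq : forall a b c d, adj a b -> adj c d ->
    pos a < pos c < pos b -> pos b < pos d ->
    pg [set a; b] != pg [set c; d] }.

Lemma mem_edges (G : sgraph) (x y : G) : adj x y -> [set x; y] \in edges G.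
Proof.
by move=> xy; rewrite inE; apply/existsP; exists x; apply/existsP; exists y;
  rewrite xy eqxx.
Qed.

Lemma edgesP (G : sgraph) (e : {set G}) :
  reflect (exists x y, adj x y /\ e = [set x; y]) (e \in edges G).
Proof.
apply: (iffP idP) => [|[x [y [xy ->]]]]; last exact: mem_edges.
rewrite inE => /existsP[x /existsP[y /andP[xy /eqP ->]]].
by exists x, y.
Qed.

Lemma mem_edges_adj (G : sgraph) (x y : G) : [set x; y] \in edges G -> adj x y.
Proof.
case/edgesP=> a [b [ab E]].
have : a \in [set x; y] by rewrite E set21.
have : b \in [set x; y] by rewrite E set22.
rewrite !inE => /orP[]/eqP Eb /orP[]/eqP Ea; subst a b; rewrite // 1?adj_sym //;
  by rewrite adj_irrefl in ab.
Qed.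

Lemma has_book_embeddingP (G : sgraph) (k : nat) :
  has_book_embedding G k <-> exists pos pg, @noncrossing G k pos pg.
Proof.
split.
  case/existsP=> pos /existsP[page /andP[/injectiveP pinj /forallP nc]].
  (* Sets that are not edges get the default page 0. *)
  pose pg (s : {set G}) : nat :=
    if (insub s : option (edge G)) is Some e then page e else 0.
  have pgE x y (xy : adj x y) :
      exists2 e : edge G, val e = [set x; y] & pg [set x; y] = page e.
    exists (Sub [set x; y] (mem_edges xy)); first by rewrite SubK.
    by rewrite /pg insubT ?mem_edges // => h; congr (val (page _)); apply: val_inj.
  exists (fun v => nat_of_ord (pos v)), pg.
  split=> [x y /val_inj/pinj //|x y /pgE[e _ ->] //|].
  move=> a b c d /pgE[e Ee ->] /pgE[f Ef ->] acb bd.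
  apply/negP=> /eqP/val_inj/eqP epf.
  have /forallP/(_ f)/implyP/(_ epf)/negP := nc e; apply.
  apply/existsP; exists a; apply/existsP; exists b; apply/existsP; exists c.
  by apply/existsP; exists d; rewrite Ee Ef !eqxx acb bd.
case=> pos [pg [pinj plt pneq]].
(* The rank of [v], the number of vertices before it, compresses the positions into ['I_#|G|] and
   keeps their order. *)
have ltG v : #|[set u | pos u < pos v]| < #|G|.
  rewrite -cardsT; apply: proper_card; apply/properP; split; first exact: subsetT.
  by exists v; rewrite ?inE ?ltnn.
have mono u v : pos u < pos v ->
    #|[set w | pos w < pos u]| < #|[set w | pos w < pos v]|.
  move=> uv; apply: proper_card; apply/properP; split.
    by apply/subsetP => w; rewrite !inE => /ltn_trans; apply.
  by exists u; rewrite !inE ?ltnn.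
have rlt u v :
    (#|[set w | pos w < pos u]| < #|[set w | pos w < pos v]|) = (pos u < pos v).
  apply/idP/idP; last exact: mono.
  case: (ltngtP (pos u) (pos v)) => // [/mono|/pinj ->]; last by rewrite ltnn.
  by move=> /ltn_trans h /h; rewrite ltnn.
have pe (e : edge G) : pg (val e) < k.
  by have /edgesP[x [y [xy ->]]] := valP e; apply: plt.
apply/existsP; exists [ffun v => Ordinal (ltG v)].
apply/existsP; exists [ffun e => Ordinal (pe e)].
apply/andP; split.
  apply/injectiveP => x y; rewrite !ffunE => -[E].
  apply: pinj; case: (ltngtP (pos x) (pos y)) => //; rewrite -rlt E ltnn //.
apply/forallP => e; apply/forallP => f; apply/implyP.
rewrite !ffunE => /eqP[pef]; apply/negP.
case/existsP=> a /existsP[b /existsP[c /existsP[d]]].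
rewrite !ffunE /= !rlt => /and3P[/eqP Ee /eqP Ef].
have ab : adj a b by apply: mem_edges_adj; rewrite -Ee; apply: (valP e).
have cd : adj c d by apply: mem_edges_adj; rewrite -Ef; apply: (valP f).
case/orP=> /andP[h1 h2].
  by have := pneq a b c d ab cd h1 h2; rewrite -Ee -Ef pef eqxx.
by have := pneq c d a b cd ab h1 h2; rewrite -Ee -Ef pef eqxx.
Qed.

Lemma pagenumber_le (G : sgraph) (k : nat) :
  has_book_embedding G k -> pagenumber G <= k.
Proof. by rewrite /pagenumber; case: ex_minnP => p _; apply. Qed.

Lemma pagenumberP (G : sgraph) : has_book_embedding G (pagenumber G).
Proof. by rewrite /pagenumber; case: ex_minnP. Qed.

(** * Lower bounds from degrees and from cliques *)

Section LowerBounds.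
Variable G : sgraph.

Lemma pagenumber_gt0 (x y : G) : adj x y -> 0 < pagenumber G.
Proof.
move=> xy; have /has_book_embeddingP[pos [pg [_ /(_ x y xy) + _]]] := pagenumberP G.
exact: leq_ltn_trans.
Qed.

(* An innermost edge with a vertex c strictly below it would enclose all
   neighbours of c; two of them are on the same side of c, which yields a
   shorter such edge. *)
Lemma pagenumber_gt1 (x : G) :
  (forall v : G, 2 < #|[pred u | adj v u]|) -> 1 < pagenumber G.
Proof.
move=> deg; have /has_book_embeddingP[pos [pg [pinj plt pneq]]] := pagenumberP G.
rewrite ltnNge; apply/negP=> le1.
have pg0 a b : adj a b -> pg [set a; b] = 0.
  by move=> /plt h; have := leq_trans h le1; case: (pg _).
have nc a b c d : adj a b -> adj c d ->
    pos a < pos c < pos b -> pos b < pos d -> False.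
  by move=> ab cd /(pneq _ _ _ _ ab cd) h /h; rewrite !pg0.
have side c : exists d e, [/\ adj c d, adj c e &
    pos d < pos e < pos c \/ pos c < pos e < pos d].
  have /card_gt2P[u [v [w [[]]]]] := deg c; rewrite !inE => cu cv cw [uv vw wu].
  have neq z : adj c z -> pos c != pos z.
    by move=> cz; apply/negP=> /eqP/pinj E; rewrite -E adj_irrefl in cz.
  have same y z : adj c y -> adj c z -> y != z ->
      (pos y < pos c) = (pos z < pos c) -> exists d e, [/\ adj c d, adj c e &
        pos d < pos e < pos c \/ pos c < pos e < pos d].
    move=> cy cz yz; move: (neq _ cy) (neq _ cz).
    have : pos y != pos z by apply: contra_neq yz => /pinj.
    case: (ltngtP (pos y) (pos z)) => // lt_yz _;
      case: (ltngtP (pos y) (pos c));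
      case: (ltngtP (pos z) (pos c)) => // zc yc _ _ _.
    - by exists y, z; split=> //; left; apply/andP.
    - by exists z, y; split=> //; right; apply/andP.
    - by exists z, y; split=> //; left; apply/andP.
    - by exists y, z; split=> //; right; apply/andP.
  (* Three truth values are never pairwise distinct, so two of the three neighbours lie on the same
     side of [c]. *)
  have [h|] := eqVneq (pos u < pos c) (pos v < pos c); first exact: (same u v).
  have [h|] := eqVneq (pos v < pos c) (pos w < pos c).
    by move=> _; exact: (same v w).
  have [h|] := eqVneq (pos w < pos c) (pos u < pos c).
    by move=> _ _; exact: (same w u).
  by do 3!case: (_ < _).
have key n : forall a b c, adj a b -> pos a < pos c < pos b ->
    pos b - pos a <= n -> False.
  elim: n => [|n IH] a b c ab acb ban; first lia.
  have [d [e [cd ce de]]] := side c.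
  have ba : adj b a by rewrite adj_sym.
  have dc : adj d c by rewrite adj_sym.
  have dL : pos a <= pos d.
    by rewrite leqNgt; apply/negP => da; apply: (nc d c a b) => //; lia.
  have dR : pos d <= pos b.
    by rewrite leqNgt; apply/negP => bd; apply: (nc a b c d) => //; lia.
  case: de => de; first by apply: (IH d c e dc); lia.
  by apply: (IH c d e cd); lia.
have [d [e [xd xe [de|de]]]] := side x; last exact: (key _ _ _ _ xd de (leqnn _)).
by rewrite adj_sym in xd; apply: (key _ _ _ _ xd de (leqnn _)).
Qed.

Lemma clique_pagenumber (S : {set G}) (q : nat) :
  1 < q -> 2 * q < #|S| -> {in S &, forall x y, x != y -> adj x y} ->
  q < pagenumber G.
Proof.
move=> q1 qS clq.
have /has_book_embeddingP[pos [pg [pinj plt pneq]]] := pagenumberP G.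
set k := pagenumber G in plt *.
have [x0 x0S] : exists x, x \in S by apply/card_gt0P; lia.
pose s := sort (relpre pos leq) (enum S).
have szs : size s = #|S| by rewrite size_sort cardE.
have mems i : i < #|S| -> nth x0 s i \in S.
  by move=> iS; rewrite -mem_enum -(mem_sort (relpre pos leq)) mem_nth ?szs.
have us : uniq s by rewrite sort_uniq enum_uniq.
have ss : sorted (relpre pos leq) s by apply: sort_sorted => x y; apply: leq_total.
have lts i j : i < j -> j < #|S| -> pos (nth x0 s i) < pos (nth x0 s j).
  move=> ij jS; have iS := ltn_trans ij jS.
  rewrite ltn_neqAle; apply/andP; split.
    by apply/negP => /eqP/pinj/eqP; rewrite nth_uniq ?szs //; lia.
  apply: (@sorted_leq_nth _ (relpre pos leq)); rewrite ?inE ?szs //;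
    last exact: ltnW.
  - by move=> y x z; apply: leq_trans.
  - by move=> y /=; apply: leqnn.
have adjs i j : i < j -> j < #|S| -> adj (nth x0 s i) (nth x0 s j).
  move=> ij jS; have iS := ltn_trans ij jS; apply: clq; rewrite ?mems //.
  by rewrite nth_uniq ?szs //; lia.
(* {l t, r t} for t <= 2q lists the long diagonals along their closed path. *)
pose l (t : nat) := t./2; pose r t := q + uphalf t.
have lr (t : 'I_(2 * q).+1) : l t < r t < #|S|.
  by rewrite /l /r; have := ltn_ord t; lia.
have flt (t : 'I_(2 * q).+1) : pg [set nth x0 s (l t); nth x0 s (r t)] < k.
  by apply: plt; have /andP[] := lr t; apply: adjs.
pose f t := Ordinal (flt t).
(* If [t < u] are not consecutive on the closed path, then [l t < l u < r t < r u] and the diagonals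
   cross. The pair [0], [2 * q] closes the path, at the common endpoint [q]. *)
have close (t u : 'I_(2 * q).+1) : f t = f u -> t < u ->
    u = t.+1 :> nat \/ t = 0 :> nat /\ u = 2 * q :> nat.
  move=> [E] tu; have [ut|ut] := eqVneq (u : nat) t.+1; first by left.
  right; have [//|/negP out] := boolP ((t == 0 :> nat) && (u == 2 * q :> nat)).
    by case/andP=> /eqP-> /eqP->.
  have [/andP[t1 t2] /andP[u1 u2]] := (lr t, lr u).
  have := ltn_ord u => uq.
  have h1 : l t < l u by rewrite /l; lia.
  have h2 : l u < r t by rewrite /l /r; lia.
  have h3 : r t < r u by rewrite /r; lia.
  have p1 := lts _ _ h1 (ltn_trans u1 u2).
  have p2 := lts _ _ h2 t2.
  have p3 := lts _ _ h3 u2.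
  have := pneq _ _ _ _ (adjs _ _ t1 t2) (adjs _ _ u1 u2).
  by rewrite E eqxx p1 p2 p3 => /(_ isT isT).
(* Three pairwise consecutive diagonals would need a closed path of length 3, but the length is
   [2 * q + 1 >= 5]. *)
have fib p : #|[pred t | f t == p]| <= 2.
  rewrite leqNgt; apply/card_gt2P => -[t [u [v [[]]]]].
  rewrite !inE => /eqP ft /eqP fu /eqP fv.
  rewrite -!val_eqE /= => -[tu uv vt].
  have c1 := close t u (etrans ft (esym fu)).
  have c2 := close u t (etrans fu (esym ft)).
  have c3 := close t v (etrans ft (esym fv)).
  have c4 := close v t (etrans fv (esym ft)).
  have c5 := close v u (etrans fv (esym fu)).
  have c6 := close u v (etrans fu (esym fv)).
  lia.
have : #|'I_(2 * q).+1| <= \sum_(p < k) 2.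
  rewrite -sum1_card (partition_big f xpredT) //=; apply: leq_sum => p _.
  by rewrite sum1_card; apply: fib.
by rewrite card_ord sum_nat_const card_ord; lia.
Qed.

End LowerBounds.

(** * Coordinates on the expansion and the lower bound *)

Section ExpansionOfComplete.
Variable n : nat.
Let G := complete_expansion (complete_graph n).
Implicit Types p q : G.

Definition base p : 'I_n := (val p).1.

(* The other end w of the edge component of p = (v, vw): the sum ranges over
   the singleton {w}. *)
Definition port p : nat := \sum_(x in (val p).2 :\ base p) (x : 'I_n).

Lemma vertexP p :
  exists w : 'I_n, [/\ w != base p, (val p).2 = [set base p; w] & port p = w].
Proof.
have /andP[/edgesP[x [y [xy E]]]] := valP p.
have nxy : x != y := xy.
rewrite /incident /port /base E !inE => /orP[]/eqP ->.
  exists y; rewrite eq_sym nxy; split=> //.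
  by rewrite setU1K ?inE // big_set1.
exists x; rewrite nxy; split=> //; first by rewrite setUC.
by rewrite setUC setU1K ?big_set1 // inE eq_sym.
Qed.

Lemma exists_vertex (v w : 'I_n) : v != w ->
  exists2 p, base p = v & (val p).2 = [set v; w].
Proof.
move=> vw.
have h : ([set v; w] \in edges (complete_graph n)) &&
    @incident (complete_graph n) v [set v; w].
  by rewrite (@mem_edges (complete_graph n)) //= /incident set21.
by exists (exist _ (v, [set v; w]) h : expansion_vertex (complete_graph n)).
Qed.

Lemma vertex_inj p q : base p = base q -> port p = port q -> p = q.
Proof.
have [w [_ Ep ->]] := vertexP p; have [x [_ Eq ->]] := vertexP q.
move=> bpq /val_inj wx; apply: val_inj.
rewrite [LHS]surjective_pairing [RHS]surjective_pairing Ep Eq wx bpq.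
by congr pair.
Qed.

(** Reduces adjacency to arithmetic: the first case is the clique edges, the second the matching
    edges. *)
Lemma adj_base_port p q : adj p q ->
  (base p = base q :> nat /\ port p <> port q) \/
  (port p = base q /\ port q = base p).
Proof.
have [w [wp Ep Pp]] := vertexP p; have [x [xq Eq Pq]] := vertexP q.
case/orP=> /andP[/eqP h1 h2].
  left; split; first exact: (congr1 val h1).
  move=> pq; move: h2; rewrite (vertex_inj h1 pq) eqxx //.
right; move: h2; rewrite Ep -[(val p).1]/(base p) -[(val q).1]/(base q) => /eqP h2.
have : base q \in [set base p; w] by rewrite h2 set22.
have : w \in [set base p; base q] by rewrite -h2 set22.
have : base p \in [set base q; x] by rewrite -Eq -h1 Ep set21.
rewrite !inE (negPf wp) /= => /orP[]/eqP bp /eqP wq _.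
  by rewrite wq bp eqxx in wp.
by rewrite Pp Pq wq bp.
Qed.

Lemma exists_mirror p : exists2 q, adj p q & base q != base p.
Proof.
have [w [wp Ep _]] := vertexP p; have [q bq Eq] := exists_vertex wp.
exists q; last by rewrite bq.
apply/orP; right; rewrite /expansion_E2 Ep Eq -[(val p).1]/(base p).
by rewrite -[(val q).1]/(base q) bq eqxx setUC eqxx.
Qed.

Definition block (v : 'I_n) : {set G} := [set p | base p == v].

Lemma block_clique v : {in block v &, forall p q, p != q -> adj p q}.
Proof.
move=> p q; rewrite !inE => /eqP pv /eqP qv pq; apply/orP; left.
rewrite /expansion_E1 -[(val p).1]/(base p) -[(val q).1]/(base q) pv qv eqxx /=.
apply: contraNneq pq => E; apply/eqP/val_inj.
rewrite [LHS]surjective_pairing [RHS]surjective_pairing E.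
by congr pair; apply: etrans pv (esym qv).
Qed.

(** Each of the [n - 1] edges at [v] is the second component of a vertex of the block. *)
Lemma leq_card_block v : n.-1 <= #|block v|.
Proof.
have <- : #|[set [set v; w] | w in [set~ v]]| = n.-1.
  rewrite card_in_imset ?cardsC1 ?card_ord // => x y; rewrite !inE => xv yv E.
  have : x \in [set v; y] by rewrite -E set22.
  by rewrite !inE (negPf xv) => /eqP.
apply: leq_trans (leq_imset_card (fun p => (val p).2) _).
apply: subset_leq_card; apply/subsetP => e /imsetP[w]; rewrite !inE => wv ->.
rewrite eq_sym in wv; have [p bp Ep] := exists_vertex wv.
by apply/imsetP; exists p; rewrite ?inE ?bp.
Qed.

(** At least [n - 2] neighbours lie in the block of [p], and one more across its matching edge. *)
Lemma leq_degree p : n.-1 <= #|[pred q | adj p q]|.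
Proof.
have [q pq bq] := exists_mirror p.
have pB : p \in block (base p) by rewrite inE.
have := leq_card_block (base p); rewrite (cardsD1 p) pB => h.
apply: leq_trans h _.
have <- : #|q |: block (base p) :\ p| = 1 + #|block (base p) :\ p|.
  by rewrite cardsU1 !inE (negPf bq) andbF.
apply: subset_leq_card; apply/subsetP => x; rewrite !inE.
case/orP=> [/eqP->//|/andP[xp /eqP bx]].
by apply: (@block_clique (base p)); rewrite ?inE ?bx // eq_sym.
Qed.

Lemma expansion_pagenumber_ge : 1 < n -> n./2 <= pagenumber G.
Proof.
move=> n1.
have [v [w vw]] : exists v w : 'I_n, v != w.
  by exists (Ordinal (ltnW n1)), (Ordinal n1).
have [p bp _] := exists_vertex vw.
(* For [n] equal to 2 or 3 the bound is 1, and a single edge forces a page. *)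
have [n3|n4] := leqP n 3.
  have [q pq _] := exists_mirror p.
  by have := pagenumber_gt0 pq; lia.
have [n5|n6] := leqP n 5.
  have := @pagenumber_gt1 G p (fun q => leq_trans _ (leq_degree q)).
  by move=> h; apply: leq_trans (h _); lia.
have := @clique_pagenumber G (block v) (n./2).-1 _ _ (@block_clique v).
by have := leq_card_block v; move=> h1 h2; have := h2 _ _; lia.
Qed.

(** * The zigzag embedding and the upper bound *)

(** For [v, w < n] this represents [v - w] modulo [n] in the range 1 to [n]; the value [n] occurs
    only for [v = w]. *)
Definition offset (v w : nat) : nat := if w < v then v - w else v + n - w.

(** Offsets of vertices are below [n], so this is the lexicographic order by base, then offset. *)
Definition spot p : nat := base p * n + offset (base p) (port p).

(** Summing over the set avoids ordering the endpoints; halving merges the residues [2p] and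
    [2p + 1]. *)
Definition page_of (e : {set G}) : nat := ((\sum_(p in e) port p) %% n)./2.

Lemma port_lt p : port p < n.
Proof. by have [w [_ _ ->]] := vertexP p. Qed.

Lemma port_neq p : port p != base p.
Proof. by have [w [wp _ ->]] := vertexP p. Qed.

Lemma offset_port p :
  0 < offset (base p) (port p) < n /\
  (offset (base p) (port p) + port p = base p \/
   offset (base p) (port p) + port p = base p + n).
Proof.
rewrite /offset; have := port_neq p; have := port_lt p.
by have := ltn_ord (base p); case: ifP; lia.
Qed.

Lemma offset_lt p : offset (base p) (port p) < n.
Proof. by have [/andP[]] := offset_port p. Qed.

Lemma spot_lt p q : spot p < spot q ->
  base p < base q \/ base p = base q :> nat /\
    offset (base p) (port p) < offset (base q) (port q).
Proof.
have := offset_lt q; rewrite /spot.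
case: (ltngtP (base p) (base q)) => [pq|qp|->]; first by left.
  by have := leq_mul2r n (base q).+1 (base p); rewrite qp orbT mulSn; lia.
by rewrite ltn_add2l; right.
Qed.

Lemma spot_inj : injective spot.
Proof.
move=> p q; rewrite /spot => E.
have n0 : 0 < n by apply: leq_ltn_trans (offset_lt p).
have Eb : base p = base q :> nat.
  have /(congr1 (divn^~ n)) := E.
  by rewrite /= !divnMDl // !divn_small ?offset_lt ?addn0.
apply: vertex_inj; first exact: val_inj.
move/eqP: E; rewrite Eb eqn_add2l /offset.
have := port_neq p; have := port_neq q; have := port_lt p; have := port_lt q.
by have := ltn_ord (base q); rewrite Eb; do 2!case: ifP; lia.
Qed.

Lemma page_ofE p q : adj p q -> page_of [set p; q] = ((port p + port q) %% n)./2.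
Proof.
move=> pq; rewrite /page_of big_setU1 ?big_set1 // inE.
by apply: contraTneq pq => ->; rewrite adj_irrefl.
Qed.

(** Turns equality of pages into linear arithmetic: a number below [2 * n] is its residue or its
    residue plus [n], and [t] is twice the common half. *)
Lemma same_page x y : x < 2 * n -> y < 2 * n -> (x %% n)./2 = (y %% n)./2 ->
  exists t, (x = t \/ x = t.+1 \/ x = t + n \/ x = t.+1 + n) /\
    (y = t \/ y = t.+1 \/ y = t + n \/ y = t.+1 + n).
Proof.
have red z : z < 2 * n -> z %% n = z \/ z = z %% n + n.
  move=> zn; case: (ltnP z n) => zn'; first by left; rewrite modn_small.
  by right; rewrite -{2}(subnK zn') modnDr modn_small; lia.
move=> /red xn /red yn E; exists ((x %% n)./2).*2.
by have := odd_double_half (x %% n); have := odd_double_half (y %% n); lia.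
Qed.

(* Vertices of the expansion are given by their base v, port w and offset d.
   Two clique edges, or a clique edge and a matching edge, that cross have port
   sums differing by at least 2 modulo n; so do two crossing matching edges with
   four distinct bases, and those with a common base never cross. *)
Lemma alternating_pages va vb vc vd wa wb wc wd da db dc dd t :
  0 < da < n /\ (da + wa = va \/ da + wa = va + n) ->
  0 < db < n /\ (db + wb = vb \/ db + wb = vb + n) ->
  0 < dc < n /\ (dc + wc = vc \/ dc + wc = vc + n) ->
  0 < dd < n /\ (dd + wd = vd \/ dd + wd = vd + n) ->
  va < n -> vb < n -> vc < n -> vd < n ->
  wa < n -> wb < n -> wc < n -> wd < n ->
  va = vb /\ wa <> wb \/ wa = vb /\ wb = va ->
  vc = vd /\ wc <> wd \/ wc = vd /\ wd = vc ->
  va < vc \/ va = vc /\ da < dc ->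
  vc < vb \/ vc = vb /\ dc < db ->
  vb < vd \/ vb = vd /\ db < dd ->
  (wa + wb = t \/ wa + wb = t.+1 \/ wa + wb = t + n \/ wa + wb = t.+1 + n) ->
  (wc + wd = t \/ wc + wd = t.+1 \/ wc + wd = t + n \/ wc + wd = t.+1 + n) ->
  False.
Proof.
move=> [offa offa'] [offb offb'] [offc offc'] [offd offd'].
do 8!move=> ?.
case=> [[]|[]] => ? ?; case=> [[]|[]] => ? ?; subst.
(* Configurations refuted without the equations linking offset, port and base go first; only the
   remaining ones are split by whether [n] is added. *)
all: do 3!(case=> [?|[? ?]]); try (clear offa' offb' offc' offd'; lia).
all: subst => abt cdt.
all: case: offa' => ?; case: offb' => ?;
  try (clear offc' offd' abt cdt; lia).
all: case: offc' => ?; case: offd' => ?; try (clear abt cdt; lia).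
all: by case: abt => [?|[?|[?|?]]]; case: cdt => [?|[?|[?|?]]]; lia.
Qed.

Lemma expansion_noncrossing : noncrossing (uphalf n) spot page_of.
Proof.
split=> [|p q pq|a b c d ab cd]; first exact: spot_inj.
  have n0 : 0 < n by apply: leq_ltn_trans (port_lt p).
  (* Residues are at most [n - 1], so their halves are below [uphalf n]. *)
  by rewrite page_ofE //; have := ltn_pmod (port p + port q) n0; lia.
move=> /andP[/spot_lt ac /spot_lt cb] /spot_lt bd.
rewrite !page_ofE //; apply/eqP => E.
have [||t [abt cdt]] := same_page _ _ E.
- by have := port_lt a; have := port_lt b; lia.
- by have := port_lt c; have := port_lt d; lia.
have off := offset_port.
apply: (alternating_pages (off a) (off b) (off c) (off d)) abt cdt => //;
  by [exact: port_lt | exact: adj_base_port].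
Qed.

End ExpansionOfComplete.

Theorem theorem3p7 (m n : nat) (hm : 0 < m) :
  (n = 2 * m -> pagenumber (complete_expansion (complete_graph n)) = m) /\
  (n = 2 * m + 1 ->
     m <= pagenumber (complete_expansion (complete_graph n)) <= m + 1).
Proof.
have ub : pagenumber (complete_expansion (complete_graph n)) <= uphalf n.
  apply: pagenumber_le; apply/has_book_embeddingP.
  by exists (@spot n), (@page_of n); apply: expansion_noncrossing.
(* [hm] gives [1 < n]; the floor and ceiling of [n / 2] agree for even [n] and differ by 1 for odd
   [n]. *)
by have := @expansion_pagenumber_ge n; split=> En; lia.
Qed.
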